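(* Let $X=(X,d,\mu)$ be a metric space equipped with a doubling measure $\mu$. Let $\emptyset\neq E\subset X$ be a closed set, and let $\alpha\in\mathbb{R}$ and $w=\delta_E^{-\alpha}$, where $\delta_E(x)=\operatorname{dist}(x,E)$. Let $\underline{\mathrm{co\,dim}}_A(E)$ denote the lower Assouad codimension of $E$. Then the following statements hold. (A) If $\underline{\mathrm{co\,dim}}_A(E)>\alpha\ge0$, then $w\in A_p$ for all $1\le p\le\infty$. (B) If $\alpha<0$ and $1<p<\infty$ are such that $\underline{\mathrm{co\,dim}}_A(E)>\dfrac{\alpha}{1-p}$, then $w\in A_p$. (C) If $\underline{\mathrm{co\,dim}}_A(E)>\max\{0,\alpha\}$, then $w\in\bigcup_{1\le p<\infty}A_p$.
   Context: $X=(X,d,\mu)$ is a metric space with at least two points, equipped with a Borel measure $\mu$ supported on $X$ such that $0<\mu(B)<\infty$ for every open ball $B=B(x,r)=\{y\in X: d(x,y)<r\}$, $x\in X$, $r>0$. The measure $\mu$ is doubling: there is $C_D>0$ with $\mu(B(x,2r))\le C_D\,\mu(B(x,r))$ for all $x\in X$, $r>0$. For $E\subset X$ and $r>0$ let $E_r=\{x\in X:\operatorname{dist}(x,E)<r\}$. The lower Assouad codimension $\underline{\mathrm{co\,dim}}_A(E)$ is the supremum of all $\rho\ge0$ for which there is a constant $C\ge1$ such that $$\frac{\mu(E_r\cap B(x,R))}{\mu(B(x,R))}\le C\Bigl(\frac rR\Bigr)^{\rho}$$ for every $x\in E$ and all $0<r<R<2\operatorname{diam}(X)$. A weight is a measurable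 function $w$ on $X$ such that $w(x)>0$ for $\mu$-almost every $x\in X$ and $\int_B w\,d\mu<\infty$ for every ball $B\subset X$; for measurable $F\subset X$ write $w(F)=\int_F w\,d\mu$. For $1<p<\infty$, a weight $w$ belongs to the Muckenhoupt class $A_p$ if there is a constant $A>0$ such that for every ball $B$ in $X$ $$\Bigl(\frac1{\mu(B)}\int_B w\,d\mu\Bigr)\Bigl(\frac1{\mu(B)}\int_B w^{-1/(p-1)}\,d\mu\Bigr)^{p-1}\le A.$$ A weight $w$ belongs to $A_1$ if there is $A>0$ such that for every ball $B$ in $X$ $$\Bigl(\frac1{\mu(B)}\int_B w\,d\mu\Bigr)\operatorname*{ess\,sup}_{y\in B}\frac1{w(y)}\le A.$$ A weight $w$ belongs to $A_\infty$ if there are constants $C>0$ and $\delta>0$ such that $w(F)\le C\bigl(\mu(F)/\mu(B)\bigr)^{\delta}w(B)$ whenever $F$ is a measurable subset of a ball $B\subset X$. Convention: $\delta_E^{-\alpha}=+\infty$ on $E$ if $\alpha>0$, and $\delta_E^0=1$. *)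

(* Defs.v *)
From HB Require Import structures.
From mathcomp Require Import all_boot all_order all_algebra.
From mathcomp Require Import all_classical all_reals all_analysis.
From mathcomp Require Import measurable_realfun ess_sup_inf.

Set Implicit Arguments.
Unset Strict Implicit.
Unset Printing Implicit Defensive.

Import Order.TTheory GRing.Theory Num.Theory.
Import numFieldNormedType.Exports.

Local Open Scope classical_set_scope.
Local Open Scope ring_scope.

(* A metric space whose measurable sets are exactly the Borel sets. Like every
   [measurableType] it is pointed, hence nonempty. *)
HB.mixin Record Metric_isBorel (d : measure_display) (R : realType) X
    & Metric R X & Measurable d X := {
  borel_measurableE : @measurable d X = <<s @open X >> }.

#[short(type="borelMetricType")]
HB.structure Definition BorelMetric (d : measure_display) (R : realType) :=
  {X of Metric R X & Measurable d X & Metric_isBorel d R X}.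

Local Open Scope ereal_scope.

Section metric.
Context {R : realType} {X : metricType R}.
Implicit Types (A E : set X) (x : X) (r : R).

(* For E nonempty this is a real number; it is +oo for E empty. *)
Definition set_dist E x : \bar R := ereal_inf [set (mdist x y)%:E | y in E].

Definition neighborhood E r : set X := [set x | set_dist E x < r%:E].

Definition diam A : \bar R :=
  ereal_sup [set (mdist xy.1 xy.2)%:E | xy in A `*` A].

End metric.

(* Real powers of x in [0, +oo] with the conventions 0 ^ s = +oo and
   (+oo) ^ s = 0 for s < 0; the library's [x `^ s] has 0 `^ s = 0 for all
   s != 0. *)
Definition epow {R : realType} (x : \bar R) (s : R) : \bar R :=
  if (s < 0)%R then (x `^ (- s))^-1 else x `^ s.

Section metric_measure_space.
Context {d : measure_display} {R : realType} {X : borelMetricType d R}.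
Variable mu : {measure set X -> \bar R}.
Implicit Types (E F B : set X) (f w : X -> \bar R) (p rho alpha : R).

(* Balls are open: [ball x r] is [set y | mdist x y < r]. *)
Definition finite_positive_on_balls : Prop :=
  forall (x : X) (r : R), (0 < r)%R -> 0 < mu (ball x r) < +oo.

Definition doubling : Prop :=
  exists2 C : R, (0 < C)%R &
    forall (x : X) (r : R), (0 < r)%R ->
      mu (ball x (2 * r)%R) <= C%:E * mu (ball x r).

Definition lower_assouad_codim_bound E rho : Prop :=
  exists2 C : R, (1 <= C)%R &
    forall (x : X) (r s : R), E x -> (0 < r < s)%R -> s%:E < 2%:E * diam [set: X] ->
      mu (neighborhood E r `&` ball x s) / mu (ball x s)
        <= (C * (r / s) `^ rho)%:E.

Definition lower_assouad_codim E : \bar R :=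
  ereal_sup
    [set rho%:E | rho in [set rho : R | (0 <= rho)%R /\ lower_assouad_codim_bound E rho]].

Definition weight w : Prop :=
  [/\ measurable_fun [set: X] w,
      {ae mu, forall x, 0 < w x} &
      forall (x : X) (r : R), (0 < r)%R -> \int[mu]_(y in ball x r) w y < +oo].

Definition average B f : \bar R := (mu B)^-1 * \int[mu]_(y in B) f y.

(* Extending f by -oo outside of B makes the library's [ess_sup], which ranges
   over the whole space, the essential supremum over B. *)
Definition ess_sup_on B f : \bar R := ess_sup mu (patch (fun=> -oo) B f).

Definition muckenhoupt_p p w : Prop :=
  exists2 A : R, (0 < A)%R &
    forall (x : X) (r : R), (0 < r)%R ->
      average (ball x r) w
        * (average (ball x r) (fun y => epow (w y) (- (p - 1)^-1))) `^ (p - 1)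
      <= A%:E.

Definition muckenhoupt_1 w : Prop :=
  exists2 A : R, (0 < A)%R &
    forall (x : X) (r : R), (0 < r)%R ->
      average (ball x r) w * ess_sup_on (ball x r) (fun y => (w y)^-1) <= A%:E.

Definition muckenhoupt_infty w : Prop :=
  exists C delta : R, [/\ (0 < C)%R, (0 < delta)%R &
    forall (x : X) (r : R) F, (0 < r)%R -> measurable F -> F `<=` ball x r ->
      \int[mu]_(y in F) w y
        <= C%:E * (mu F / mu (ball x r)) `^ delta * \int[mu]_(y in ball x r) w y].

(* The classes A_p for 1 <= p <= +oo; the set is empty for other values of p. *)
Definition muckenhoupt (p : \bar R) : set (X -> \bar R) :=
  [set w | weight w /\
    match p with
    | q%:E => if q == 1%R then muckenhoupt_1 w
              else (1 < q)%R /\ muckenhoupt_p q w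
    | +oo => muckenhoupt_infty w
    | -oo => False
    end].

End metric_measure_space.

Definition dist_weight {R : realType} {X : metricType R} (E : set X) (alpha : R) :
    X -> \bar R :=
  fun x => epow (set_dist E x) (- alpha).

(* Main.v *)
Require Import Defs.
From mathcomp Require Import all_boot all_order all_algebra.
From mathcomp Require Import all_classical all_reals all_analysis.
From mathcomp Require Import measurable_realfun ess_sup_inf.
From mathcomp Require Import ring lra.

Set Implicit Arguments.
Unset Strict Implicit.
Unset Printing Implicit Defensive.

Import Order.TTheory GRing.Theory Num.Theory.
Import numFieldNormedType.Exports.

Local Open Scope classical_set_scope.
Local Open Scope ring_scope.
Local Open Scope ereal_scope.

(** The weight [w = dist_weight E alpha] is [dist_to E `^ (- alpha)], with the value
    [+oo] on the zero set of the distance when [alpha > 0].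

    Everything rests on one integral estimate. If [beta] is positive and smaller
    than the lower Assouad codimension of [E], then, over a ball of radius [t]
    centered on [E], [dist_to E `^ (- beta)] has average at most a constant times
    [t `^ (- beta)] ([integral_dist_weight_ball_center]): cutting the ball into the
    dyadic layers where [dist_to E] is about [t / 2 ^+ j], the growth of the
    integrand is beaten by the decay of the measure of the layers, and a geometric
    series remains. For [beta <= 0] the same bound is trivial.

    An arbitrary ball [B] has a scale [t] relative to [E] ([exists_ball_scale]):
    either [B] is far from [E], and [dist_to E] is comparable to a constant [t] on
    it, or, by doubling, [B] lies in a ball of radius [t] centered on [E] with
    comparable measure. In both cases [dist_to E <= t] on [B], and the average of
    [dist_to E `^ (- beta)] over [B] is at most a constant times [t `^ (- beta)] for
    every admissible [beta], that is, nonpositive or below the codimension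
    ([integral_dist_weight_ball]). It remains to play these
    bounds against each other, the powers of [t] cancelling each time.
    - [A_p] for [1 < p] finite: the dual weight [w `^ (- (p - 1)^-1)] is the power of
      the distance of exponent [alpha / (1 - p)], so [w] is in [A_p] as soon as both
      [alpha] and [alpha / (1 - p)] are admissible. For [alpha >= 0] the second is
      nonpositive, for [alpha < 0] the first is, which gives (A) and (B); and
      [alpha / (1 - p)] tends to [0] as [p] grows, which gives (C).
    - [A_1]: [w^-1 = dist_to E `^ alpha <= t `^ alpha] on [B].
    - [A_oo]: with [gamma > alpha] still below the codimension, splitting a subset
      of [B] at a well chosen distance from [E] bounds [w] by a constant on one part
      and by a multiple of [dist_to E `^ (- gamma)] on the other. *)

(** * Extended powers *)

Section epow.
Context {R : realType}.
Implicit Types (a b s u : R) (x : \bar R).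

Lemma epow_ge0 x s : 0 <= epow x s.
Proof. by rewrite /epow; case: ifP => _; rewrite ?inve_ge0 poweR_ge0. Qed.

Lemma epowe0 x : epow x 0 = 1.
Proof. by rewrite /epow ltxx poweRe0. Qed.

Lemma epow_EFin a s : (0 < a)%R -> epow a%:E s = (a `^ s)%:E.
Proof.
move=> a0; rewrite /epow; case: ifPn => // _.
by rewrite poweR_EFin inver gt_eqF ?powR_gt0// powRN invrK.
Qed.

Lemma epow0_gt0 s : (0 < s)%R -> epow 0 s = 0.
Proof. by move=> s0; rewrite /epow ifF ?poweR0r ?gt_eqF// ltNge ltW. Qed.

Lemma epow0_lt0 s : (s < 0)%R -> epow 0 s = +oo.
Proof. by move=> s0; rewrite /epow s0 poweR0r ?inve0// oppr_eq0 lt_eqF. Qed.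

Lemma epowy_gt0 s : (0 < s)%R -> epow +oo s = +oo.
Proof. by move=> s0; rewrite /epow ifF ?poweRyr ?gt_eqF// ltNge ltW. Qed.

Lemma epowy_lt0 s : (s < 0)%R -> epow +oo s = 0.
Proof. by move=> s0; rewrite /epow s0 poweRyr ?invey// oppr_eq0 lt_eqF. Qed.

Lemma inve_epow x s : (epow x s)^-1 = epow x (- s).
Proof.
rewrite /epow oppr_lt0; case: (ltgtP s 0%R) => [s0|s0|->].
- by rewrite inveK.
- by rewrite opprK.
- by rewrite oppr0 poweRe0 inve1.
Qed.

Lemma epow_epow a s u : (0 <= a)%R ->
  epow (epow a%:E s) u = epow a%:E (s * u).
Proof.
rewrite le_eqVlt => /predU1P[<-|a0]; last first.
  by rewrite !epow_EFin ?powR_gt0// powRrM.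
case: (ltgtP s 0%R) => [s0|s0|->].
- rewrite (epow0_lt0 s0); case: (ltgtP u 0%R) => [u0|u0|->].
  + by rewrite epowy_lt0// epow0_gt0// nmulr_rgt0.
  + by rewrite epowy_gt0// epow0_lt0// nmulr_rlt0.
  + by rewrite mulr0 !epowe0.
- rewrite (epow0_gt0 s0); case: (ltgtP u 0%R) => [u0|u0|->].
  + by rewrite !epow0_lt0// pmulr_rlt0.
  + by rewrite !epow0_gt0// mulr_gt0.
  + by rewrite mulr0 !epowe0.
- by rewrite mul0r !epowe0 epow_EFin// powR1.
Qed.

Lemma le_epow a b s : (0 <= s)%R -> (0 <= a <= b)%R ->
  epow a%:E s <= epow b%:E s.
Proof.
move=> s0 /andP[a0 ab]; rewrite /epow ltNge s0/= lee_fin.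
by rewrite ge0_ler_powR// nnegrE// (le_trans a0).
Qed.

Lemma ge_epow a b s : (s <= 0)%R -> (0 <= a <= b)%R ->
  epow b%:E s <= epow a%:E s.
Proof.
move=> s0 ab; rewrite -[s]opprK -(inve_epow a%:E) -(inve_epow b%:E) lee_pV2 ?inE ?epow_ge0//.
by rewrite le_epow// oppr_ge0.
Qed.

Lemma measurable_epow_EFin s :
  measurable_fun [set: R] (fun a : R => epow a%:E s).
Proof.
rewrite (_ : (fun a => _) =
    fun a => if a == 0%R then epow 0 s else (a `^ s)%:E); last first.
  apply/funext => a; case: eqVneq => [->//|a0].
  rewrite /epow; case: ifPn => // _.
  by rewrite poweR_EFin inver powR_eq0 (negPf a0)/= powRN invrK.
apply: measurable_fun_ifT => //; first exact: measurable_fun_eqr.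
by apply/measurable_EFinP; exact: measurable_powR.
Qed.

End epow.

(** * Distance to a set *)

Section dist_to.
Context {R : realType} {X : metricType R}.
Implicit Types (E : set X) (x y z : X) (r s : R).

Definition dist_to E x : R := fine (set_dist E x).

Lemma set_distE E x : E !=set0 -> set_dist E x = (dist_to E x)%:E.
Proof.
move=> [z Ez]; rewrite /dist_to fineK// ge0_fin_numE.
  by rewrite (le_lt_trans (ereal_inf_lbound (imageP _ Ez)))// ltry.
by apply: le_ereal_inf_tmp => _ [y _ <-]; rewrite lee_fin mdist_ge0.
Qed.

Lemma dist_to_ge0 E x : (0 <= dist_to E x)%R.
Proof.
by rewrite fine_ge0//; apply: le_ereal_inf_tmp => _ [y _ <-]; rewrite lee_fin mdist_ge0.
Qed.

Lemma dist_to_le E x z : E z -> (dist_to E x <= mdist x z)%R.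
Proof.
move=> Ez; rewrite -lee_fin -set_distE; last by exists z.
exact: ereal_inf_lbound (imageP _ Ez).
Qed.

Lemma dist_to_lt E x r : E !=set0 -> (dist_to E x < r)%R ->
  exists2 z, E z & (mdist x z < r)%R.
Proof.
move=> E0; rewrite -lte_fin -set_distE// => /ereal_inf_lt[_ [z Ez <-]].
by rewrite lte_fin => ?; exists z.
Qed.

Lemma dist_to_lipschitz E x y : E !=set0 ->
  (dist_to E x <= mdist x y + dist_to E y)%R.
Proof.
move=> E0; rewrite -lerBlDl -lee_fin -(set_distE y E0).
apply: le_ereal_inf_tmp => _ [z Ez <-]; rewrite lee_fin lerBlDl.
by rewrite (le_trans (dist_to_le x Ez))// metric_triangle.
Qed.

Lemma neighborhoodE E r : E !=set0 ->
  neighborhood E r = [set x | (dist_to E x < r)%R].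
Proof.
by move=> E0; apply/seteqP; split => x; rewrite /neighborhood/= set_distE.
Qed.

Lemma metric_open_ball x r : open (ball x r).
Proof.
rewrite openE => y; rewrite ballEmdist/= => xyr.
apply/nbhs_ballP; exists (r - mdist x y)%R => /=; first by rewrite subr_gt0.
move=> z; rewrite !ballEmdist/= ltrBrDl => /(le_lt_trans _); apply.
exact: metric_triangle.
Qed.

Lemma open_neighborhood E r : E !=set0 -> open (neighborhood E r).
Proof.
move=> E0; rewrite (_ : neighborhood E r = \bigcup_(z in E) ball z r); last first.
  apply/seteqP; split => [x|x [z Ez]]; rewrite neighborhoodE//=.
    move=> /(dist_to_lt E0)[z Ez xz]; exists z => //.
    by rewrite ballEmdist/= metric_sym.
  rewrite ballEmdist/= metric_sym => xz.
  exact: le_lt_trans (dist_to_le x Ez) xz.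
by apply: bigcup_open => z _; exact: metric_open_ball.
Qed.

Lemma dist_weight_pos E x s : E !=set0 -> (0 < dist_to E x)%R ->
  dist_weight E s x = (dist_to E x `^ (- s))%:E.
Proof. by move=> E0 x0; rewrite /dist_weight set_distE// epow_EFin. Qed.

End dist_to.

Section borel_metric.
Context {d : measure_display} {R : realType} {X : borelMetricType d R}.
Implicit Types (E : set X) (x : X) (r : R).

Lemma measurable_open (A : set X) : open A -> measurable A.
Proof. by rewrite borel_measurableE => oA; exact: sub_sigma_algebra. Qed.

Lemma measurable_metric_ball x r : measurable (ball x r : set X).
Proof. exact/measurable_open/metric_open_ball. Qed.

Lemma measurable_neighborhood E r : E !=set0 -> measurable (neighborhood E r).
Proof. by move=> E0; exact/measurable_open/open_neighborhood. Qed.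

Lemma measurable_dist_to E : E !=set0 -> measurable_fun [set: X] (dist_to E).
Proof.
move=> E0 mT; apply: (measurability _ (RGenInftyO.measurableE R)) => //.
move=> _ [_ [r ->] <-]; rewrite setTI.
suff -> : dist_to E @^-1` `]-oo, r[ = neighborhood E r.
  exact: measurable_neighborhood.
by rewrite neighborhoodE//; apply/seteqP; split => x /=; rewrite in_itv.
Qed.

Lemma measurable_dist_weight E s (D : set X) : E !=set0 ->
  measurable_fun D (dist_weight E s).
Proof.
move=> E0; apply: measurable_funTS.
rewrite (_ : dist_weight E s = (fun a : R => epow a%:E (- s)) \o dist_to E).
  apply: measurableT_comp; [exact: measurable_epow_EFin|exact: measurable_dist_to].
by apply/funext => x; rewrite /dist_weight set_distE.
Qed.

End borel_metric.

(** * Integrating powers of the distance *)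

Section dyadic.
Context {R : realType}.
Implicit Types (a b t s beta : R) (j n : nat).

Lemma ler_npowR a b s : (s <= 0)%R -> (0 < a <= b)%R -> (b `^ s <= a `^ s)%R.
Proof.
move=> s0 /andP[a0 ab]; have b0 := lt_le_trans a0 ab.
by rewrite -lee_fin -!epow_EFin// ge_epow// (ltW a0).
Qed.

Lemma powR_inv2X s n : ((2 ^+ n)^-1 `^ s = (2 `^ (- s)) ^+ n :> R)%R.
Proof.
rewrite -powR_invn// -powRrM -powR_mulrn ?powR_ge0// -powRrM; congr (_ `^ _)%R.
by rewrite mulNr mulrC mulNr.
Qed.

Lemma dyadic_scale a t : (0 < a < t)%R ->
  exists j, (t / 2 ^+ j.+1 <= a < t / 2 ^+ j)%R.
Proof.
move=> /andP[a0 at_]; have t0 := lt_trans a0 at_.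
have [n tn] : exists n, (t / 2 ^+ n.+1 <= a)%R.
  exists (Num.bound (t / a)); rewrite ler_pdivrMr ?exprn_gt0// mulrC.
  rewrite -ler_pdivrMr// (le_trans (ltW (archi_boundP _)))//.
    by rewrite divr_ge0 ?ltW.
  by rewrite -natrX ler_nat ltnW// ltnW// ltn_expl.
case: (ex_minnP (ex_intro (fun n => _ <= a)%R n tn)) => j tj jmin.
exists j; rewrite tj/=; case: j tj jmin => [|j] tj jmin.
  by rewrite expr0 divr1.
by rewrite ltNge; apply/negP => /jmin; rewrite ltnn.
Qed.

(** A distance [0 < a < t] lies in the layer [t / 2 ^+ j.+1 <= a < t / 2 ^+ j]
    of some [j], whose term alone dominates [a `^ (- beta)]; when [a = 0] all the
    terms are present and the series diverges, so the points of the set itself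
    need no separate treatment. *)
Lemma epow_le_dyadic a t beta : (0 < beta)%R -> (0 <= a < t)%R ->
  epow a%:E (- beta) <=
    \sum_(j <oo) ((t / 2 ^+ j.+1) `^ (- beta) * (a < t / 2 ^+ j)%R%:R)%:E.
Proof.
move=> b0 /andP[a0 at_]; have t0 : (0 < t)%R := le_lt_trans a0 at_.
set u := (X in limn (fun n => \sum_(0 <= i < n) X i)).
have u0 n : 0 <= u n by rewrite lee_fin mulr_ge0 ?powR_ge0.
have tj j : (0 < t / 2 ^+ j)%R by rewrite divr_gt0 ?exprn_gt0.
move: a0; rewrite le_eqVlt => /predU1P[a0|a0].
  rewrite -a0 epow0_lt0 ?oppr_lt0// leye_eq; apply/eqP/eq_infty => r.
  pose c := ((t / 2) `^ (- beta))%R.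
  have c0 : (0 < c)%R by rewrite powR_gt0// divr_gt0.
  pose k := Num.bound (`|r| / c).
  apply: le_trans (nneseries_lim_ge k (fun n _ _ => u0 n)).
  apply: (@le_trans _ _ (\sum_(0 <= j < k) c%:E)).
    rewrite sumEFin lee_fin sumr_const_nat subn0 -mulr_natr mulrC -ler_pdivrMr//.
    have h : (r / c <= `|r| / c)%R by rewrite ler_pM2r ?invr_gt0// ler_norm.
    by rewrite (le_trans h)// ltW// archi_boundP// divr_ge0// ltW.
  apply: lee_sum => j _; rewrite lee_fin -a0 tj mulr1 ler_npowR ?oppr_le0 ?(ltW b0)//.
  rewrite tj/= ler_pM2l// lef_pV2 ?posrE ?exprn_gt0// exprS ler_peMr//.
  by rewrite exprn_ege1// ler1n.
have [j /andP[ja aj]] := dyadic_scale (introT andP (conj a0 at_)).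
rewrite epow_EFin//; apply: (@le_trans _ _ (u j)).
  by rewrite /u aj mulr1 lee_fin ler_npowR ?tj// oppr_le0 ltW.
apply: le_trans (nneseries_lim_ge j.+1 (fun n _ _ => u0 n)).
by rewrite big_nat_recr//= leeDr// sume_ge0.
Qed.

Lemma nneseries_geometric (M q : R) : (0 <= q < 1)%R ->
  \sum_(j <oo) (M * q ^+ j)%:E = (M / (1 - q))%:E.
Proof.
move=> /andP[q0 q1]; apply/cvg_lim => //.
rewrite (_ : (fun _ => _) = EFin \o series (geometric M q)); last first.
  by apply/funext => n /=; rewrite sumEFin.
apply: cvg_EFin; first by apply: nearW.
by apply: cvg_geometric_series; rewrite ger0_norm.
Qed.

End dyadic.

Section aikawa.
Context {d : measure_display} {R : realType} {X : borelMetricType d R}.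
Context (mu : {measure set X -> \bar R}) (E : set X).
Context (mu_balls : finite_positive_on_balls mu).
Context (E0 : E !=set0).

Lemma measure_ball_fin x r : (0 < r)%R ->
  exists2 m : R, (0 < m)%R & mu (ball x r) = m%:E.
Proof.
move=> r0; have := mu_balls x r0; case: (mu (ball x r)) => [m| |]//.
  by rewrite lte_fin => /andP[m0 _]; exists m.
by rewrite ltxx andbF.
Qed.

Lemma measure_dyadic_neighborhood_le rho : lower_assouad_codim_bound mu E rho ->
  exists2 C : R, (1 <= C)%R & forall z t j, E z -> (0 < t)%R ->
    t%:E < 2%:E * diam [set: X] ->
    mu (neighborhood E (t / 2 ^+ j)%R `&` ball z t) <=
      (C * (2 `^ (- rho)) ^+ j)%:E * mu (ball z t).
Proof.
move=> [C C1 hC]; exists C => // z t j Ez t0 tX.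
have [m m0 mE] := measure_ball_fin z t0.
(* the codimension bound only covers radii below [t]; at [j = 0], [1 <= C] suffices *)
case: j => [|j].
  rewrite expr0 divr1 expr0 mulr1 (@le_trans _ _ (mu (ball z t)))//.
    rewrite le_measure// ?inE; [|exact: measurable_metric_ball].
    by apply: measurableI; [exact: measurable_neighborhood|exact: measurable_metric_ball].
  by rewrite mE lee_fin ler_peMl// ltW.
have := hC z (t / 2 ^+ j.+1)%R t Ez _ tX; rewrite mE inver gt_eqF//.
rewrite lee_pdivrMr// (mulrC t) mulfK ?gt_eqF// powR_inv2X; apply.
by rewrite mulr_gt0 ?invr_gt0 ?exprn_gt0//= gtr_pMl// invf_lt1 ?exprn_gt0// exprn_egt1// ltr1n.
Qed.

(** Aikawa's condition for [E]. Take [rho > beta] in the set defining the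
    codimension: the layer [dist_to E < t / 2 ^+ j] has relative measure at most
    [C * 2 `^ (- rho * j)], and its term in the dyadic series of [dist_weight E beta]
    is of order [t `^ (- beta) * 2 `^ (beta * j)], so that the integral is dominated
    by a geometric series of ratio [2 `^ (beta - rho) < 1]. *)
Lemma integral_dist_weight_ball_center (beta : R) : (0 < beta)%R ->
  beta%:E < lower_assouad_codim mu E ->
  exists2 K : R, (0 < K)%R & forall z t, E z -> (0 < t)%R ->
    t%:E < 2%:E * diam [set: X] ->
    \int[mu]_(y in ball z t) dist_weight E beta y <=
      (K * t `^ (- beta))%:E * mu (ball z t).
Proof.
move=> b0 /ereal_sup_gt[_ [rho [rho0 /measure_dyadic_neighborhood_le[C C1 hC]] <-]].
rewrite lte_fin => brho.
pose q := (2 `^ (beta - rho))%R.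
have q01 : (0 <= q < 1)%R.
  rewrite powR_ge0/= -[ltRHS](powRr0 2) /q /powR !gt_eqF//.
  by rewrite ltr_expR mul0r pmulr_llt0 ?subr_lt0// ln_gt0// ltr1n.
exists (C * 2 `^ beta / (1 - q))%R.
  rewrite divr_gt0 ?mulr_gt0 ?powR_gt0 ?(lt_le_trans ltr01 C1)//.
  by rewrite subr_gt0; case/andP: q01.
move=> z t Ez t0 tX.
have [m m0 mE] := measure_ball_fin z t0.
have tj j : (0 < t / 2 ^+ j)%R by rewrite divr_gt0 ?exprn_gt0.
have mB := measurable_metric_ball z t.
have mN j := measurable_neighborhood (t / 2 ^+ j) E0.
pose c j := ((t / 2 ^+ j.+1) `^ (- beta))%R.
pose f j y := (c j * \1_(neighborhood E (t / 2 ^+ j)) y)%:E : \bar R.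
have c_ge0 j : (0 <= c j)%R by exact: powR_ge0.
have f0 j y : 0 <= f j y by rewrite lee_fin mulr_ge0.
have mf j : measurable_fun (ball z t) (f j).
  by apply/measurable_EFinP; apply: measurable_funM => //; exact: measurable_indic.
apply: (@le_trans _ _ (\int[mu]_(y in ball z t) \sum_(j <oo) f j y)).
  apply: ge0_le_integral => //.
  - by move=> y _; exact: epow_ge0.
  - exact: measurable_dist_weight.
  - by apply: (ge0_emeasurable_sum (P := xpredT)).
  - move=> y; rewrite ballEmdist/= metric_sym => yz.
    rewrite /dist_weight set_distE//.
    have yt : (0 <= dist_to E y < t)%R.
      by rewrite dist_to_ge0/= (le_lt_trans (dist_to_le y Ez)).
    apply: (le_trans (epow_le_dyadic b0 yt)).
    apply: lee_nneseries => [j _ _|j _]; first by rewrite lee_fin mulr_ge0 ?powR_ge0.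
    by rewrite /f neighborhoodE// indicE mem_setE.
rewrite integral_nneseries//.
apply: (@le_trans _ _ (\sum_(j <oo) ((C * 2 `^ beta * t `^ (- beta) * m) * q ^+ j)%:E)).
  apply: lee_nneseries => [j _ _|j _]; first exact: integral_ge0.
  under eq_integral do rewrite /f EFinM.
  rewrite ge0_integralZl//; last 2 first.
  - by apply/measurable_EFinP; exact: measurable_indic.
  - by rewrite lee_fin.
  rewrite integral_indic//.
  apply: (@le_trans _ _ ((c j)%:E * ((C * (2 `^ (- rho)) ^+ j)%:E * mu (ball z t)))).
    by rewrite lee_wpmul2l ?lee_fin// hC.
  rewrite mE -!EFinM lee_fin /c powRM ?invr_ge0 ?exprn_ge0 ?(ltW t0)//.
  rewrite powR_inv2X opprK exprS /q powRD; last by apply/implyP => _; rewrite gt_eqF.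
  by rewrite exprMn le_eqVlt; apply/orP; left; apply/eqP; ring.
rewrite nneseries_geometric// mE -EFinM lee_fin le_eqVlt; apply/orP; left; apply/eqP.
ring.
Qed.

End aikawa.

(** * Scale of a ball relative to a set *)

Section integral_cst_bounds.
Context {d : measure_display} {T : measurableType d} {R : realType}.
Context {mu : {measure set T -> \bar R}} {D : set T} {f : T -> \bar R}.
Context (mD : measurable D) (mf : measurable_fun D f).
Context (f0 : forall x, D x -> 0 <= f x).

Lemma integral_le_cst (c : \bar R) : (forall x, D x -> f x <= c) ->
  \int[mu]_(x in D) f x <= c * mu D.
Proof.
move=> fc; by rewrite -integral_cst//; apply: ge0_le_integral.
Qed.

Lemma integral_ge_cst (c : \bar R) : 0 <= c -> (forall x, D x -> c <= f x) ->
  c * mu D <= \int[mu]_(x in D) f x.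
Proof.
move=> c0 fc; by rewrite -integral_cst//; apply: ge0_le_integral.
Qed.

End integral_cst_bounds.

Section ball_scale.
Context {d : measure_display} {R : realType} {X : borelMetricType d R}.
Context (mu : {measure set X -> \bar R}) (E : set X).
Context (mu_balls : finite_positive_on_balls mu) (E0 : E !=set0).

(** [t] is the size of [dist_to E] on [ball x r]: either the ball is far from [E]
    and [dist_to E] is comparable to [t] on all of it, or the ball sits inside a
    ball of radius [t] centered on [E] that is not much larger than itself. All
    the Muckenhoupt conditions are then checked at the single scale [t]. *)
Definition ball_scale (D : R) x r t :=
  [/\ (0 < t)%R, forall y, ball x r y -> (dist_to E y <= t)%R &
      (forall y, ball x r y -> (t <= 3 * dist_to E y)%R) \/
      exists z, [/\ E z, t%:E < 2%:E * diam [set: X],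
        ball x r `<=` ball z t & mu (ball z t) <= D%:E * mu (ball x r)]].

(** The factor [D] is [C ^+ 3] for a doubling constant [C], because a ball near [E]
    lies in some [ball z t] with [ball z t `<=` ball x (2 * (2 * (2 * r)))]. *)
Lemma exists_ball_scale : (exists x y : X, x <> y) -> doubling mu ->
  exists2 D : R, (0 < D)%R & forall x r, (0 < r)%R -> exists t, ball_scale D x r t.
Proof.
move=> [a [b ab]] [C C0 hC]; exists (C ^+ 3)%R; first by rewrite exprn_gt0.
move=> x r r0.
have [far|near] := leP (2 * r)%R (dist_to E x).
  exists (3 / 2 * dist_to E x)%R; split.
  - by rewrite mulr_gt0// (lt_le_trans _ far)// mulr_gt0.
  - move=> y; rewrite ballEmdist/= metric_sym => xy.
    by have := dist_to_lipschitz y x E0; lra.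
  - left => y; rewrite ballEmdist/= => xy.
    by have := dist_to_lipschitz x y E0; lra.
have [z Ez xz] := dist_to_lt E0 near.
have diamP (u v : X) : (mdist u v)%:E <= diam [set: X].
  by apply: ereal_sup_ubound; exists (u, v).
(* When [3 * r] exceeds the range of radii allowed by the codimension, the space
   is bounded and any radius strictly between one and two diameters fits, as the
   ball centered at [z] is then the whole space. *)
have [t [t0 t3 tX xzt]] : exists t : R, [/\ (0 < t)%R, (t <= 3 * r)%R,
    t%:E < 2%:E * diam [set: X] & ball x r `<=` ball z t].
  have [r3|] := ltP (3 * r)%:E (2%:E * diam [set: X]).
    exists (3 * r)%R; split => //; first by rewrite mulr_gt0.
    move=> y; rewrite !ballEmdist/= => xy.
    by have := metric_triangle z x y; rewrite (metric_sym z x); lra.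
  have ab0 : (0 < mdist a b)%R by rewrite mdist_gt0; exact/eqP.
  have := diamP a b.
  case: (diam _) diamP => [v| |] diamP; last 2 first.
  - by rewrite gt0_muley ?leye_eq// lte_fin.
  - by rewrite leeNy_eq.
  rewrite !lee_fin => abv v3; exists (3 / 2 * v)%R; split.
  - by lra.
  - by lra.
  - by rewrite -EFinM lte_fin; lra.
  - by move=> y _; rewrite ballEmdist/=; have := diamP z y; rewrite lee_fin; lra.
exists t; split => //.
  move=> y /xzt; rewrite ballEmdist/= metric_sym => yz.
  by rewrite (le_trans (dist_to_le y Ez))// ltW.
right; exists z; split => //.
have doubled s : (0 < s)%R -> mu (ball x (2 * s)) <= C%:E * mu (ball x s).
  exact: hC.
apply: (@le_trans _ _ (mu (ball x (2 * (2 * (2 * r)))))).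
  rewrite le_measure ?inE; [by []|exact: measurable_metric_ball..|].
  move=> y; rewrite !ballEmdist/= => zy.
  by have := metric_triangle x z y; lra.
have r2 : (0 < 2 * r)%R by rewrite mulr_gt0.
have r4 : (0 < 2 * (2 * r))%R by rewrite mulr_gt0.
have c0 : 0 <= C%:E by rewrite lee_fin ltW.
rewrite (le_trans (doubled _ r4))// !exprS expr0 mulr1 !EFinM -!muleA.
rewrite lee_wpmul2l// (le_trans (doubled _ r2))// lee_wpmul2l//.
exact: doubled.
Qed.

(** A nonpositive exponent is free, because [dist_weight E beta] is then bounded by
    its value at the scale of the ball. *)
Definition integrable_exponent (beta : R) :=
  (beta <= 0)%R \/ beta%:E < lower_assouad_codim mu E.

(** The estimate of [integral_dist_weight_ball_center] passes to all balls: near [E]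
    by enlarging the ball to the one centered on [E], far from [E] because,
    for [beta > 0], the weight is pointwise at most [3 `^ beta] times [t `^ (- beta)]. *)
Lemma integral_dist_weight_ball (D beta : R) : (0 < D)%R ->
  integrable_exponent beta ->
  exists2 K : R, (0 < K)%R & forall x r t, (0 < r)%R -> ball_scale D x r t ->
    \int[mu]_(y in ball x r) dist_weight E beta y <=
      (K * t `^ (- beta))%:E * mu (ball x r).
Proof.
move=> D0 hb.
have mB (x : X) (r : R) : measurable (ball x r) := measurable_metric_ball x r.
have mw (A : set X) s := @measurable_dist_weight _ _ _ E s A E0.
have w0 y : 0 <= dist_weight E beta y by exact: epow_ge0.
have [b0|b0] := leP beta 0%R.
  exists 1%R => // x r t r0 [t0 dt _]; rewrite mul1r.
  apply: (integral_le_cst (mB _ _) (mw _ _) (fun y _ => w0 y)) => y /dt yt.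
  rewrite /dist_weight set_distE// -epow_EFin//.
  by rewrite le_epow ?oppr_ge0// dist_to_ge0.
case: hb => [|hb]; first by rewrite leNgt b0.
have [K K0 hK] := integral_dist_weight_ball_center mu_balls E0 b0 hb.
exists (K * D + 3^-1 `^ (- beta))%R; first by rewrite addr_gt0 ?mulr_gt0 ?powR_gt0.
move=> x r t r0 [t0 dt] [ht|[z [Ez tX xzt Dt]]].
  apply: (@le_trans _ _ ((3^-1 `^ (- beta) * t `^ (- beta))%:E * mu (ball x r))).
    apply: (integral_le_cst (mB _ _) (mw _ _) (fun y _ => w0 y)) => y /ht ty.
    have y0 : (0 < dist_to E y)%R by lra.
    rewrite dist_weight_pos// lee_fin -powRM ?(ltW t0)//.
    by rewrite ler_npowR ?oppr_le0 ?(ltW b0)//; apply/andP; split; lra.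
  rewrite lee_wpmul2r// lee_fin ler_pM2r ?powR_gt0//.
  by rewrite lerDr mulr_ge0 ?ltW.
apply: (@le_trans _ _ (\int[mu]_(y in ball z t) dist_weight E beta y)).
  exact: (ge0_subset_integral _ (mB _ _) (mB _ _) (mw _ _) (fun y _ => w0 y)).
apply: le_trans (hK z t Ez t0 tX) _.
apply: (@le_trans _ _ ((K * t `^ (- beta))%:E * (D%:E * mu (ball x r)))).
  by rewrite lee_wpmul2l// lee_fin mulr_ge0 ?powR_ge0// ltW.
rewrite muleA -EFinM lee_wpmul2r// lee_fin mulrAC ler_pM2r ?powR_gt0//.
by rewrite lerDl powR_ge0.
Qed.

End ball_scale.

(** * Muckenhoupt conditions for powers of the distance *)

Section muckenhoupt_dist_weight.
Context {d : measure_display} {R : realType} {X : borelMetricType d R}.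
Context (mu : {measure set X -> \bar R}) (E : set X).
Context (mu_balls : finite_positive_on_balls mu) (E0 : E !=set0).
Context {D : R} (D0 : (0 < D)%R).
Context (scaleP : forall x r, (0 < r)%R -> exists t, ball_scale mu E D x r t).

Let mB (x : X) (r : R) : measurable (ball x r) := measurable_metric_ball x r.
Let mw (A : set X) s : measurable_fun A (dist_weight E s) :=
  measurable_dist_weight (D := A) s E0.
Let w0 s y : 0 <= dist_weight E s y := epow_ge0 _ _.

Lemma average_ge0 (A : set X) f : (forall y, 0 <= f y) -> 0 <= average mu A f.
Proof. by move=> f0; rewrite mule_ge0 ?inve_ge0// integral_ge0. Qed.

Lemma average_dist_weight_le (beta : R) : integrable_exponent mu E beta ->
  exists2 K : R, (0 < K)%R & forall x r t, (0 < r)%R -> ball_scale mu E D x r t ->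
    average mu (ball x r) (dist_weight E beta) <= (K * t `^ (- beta))%:E.
Proof.
move=> hb; have [K K0 hK] := integral_dist_weight_ball mu_balls E0 D0 hb.
exists K => // x r t r0 /(hK x r t r0).
have [m m0 mE] := measure_ball_fin mu_balls x r0.
by rewrite /average mE inver gt_eqF// lee_pdivrMl// muleC.
Qed.

Lemma exponent_above (alpha : R) : alpha%:E < lower_assouad_codim mu E ->
  exists2 gamma : R, (alpha < gamma)%R & gamma%:E < lower_assouad_codim mu E.
Proof.
move=> /ereal_sup_gt[_ [rho hrho <-]]; rewrite lte_fin => arho.
exists ((alpha + rho) / 2)%R; first by lra.
apply: (@lt_le_trans _ _ rho%:E); first by rewrite lte_fin; lra.
by apply: ereal_sup_ubound; exists rho.
Qed.

(** Negative powers of the distance are infinite on this set, so one such power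
    that is integrable over balls makes it negligible. For [alpha < 0] this is the
    set where [dist_weight E alpha] vanishes. *)
Lemma negligible_dist_to_eq0 : 0 < lower_assouad_codim mu E ->
  mu.-negligible [set y | dist_to E y = 0%R].
Proof.
move=> /exponent_above[beta b0 /or_intror hb].
have [K K0 hK] := integral_dist_weight_ball mu_balls E0 D0 (hb _).
set Z := [set y | dist_to E y = 0%R].
have mZ : measurable Z.
  rewrite (_ : Z = dist_to E @^-1` [set 0%R]); last by [].
  by rewrite -[_ @^-1` _]setTI; exact: measurable_dist_to.
have [x _] := E0.
rewrite (_ : Z = \bigcup_n (Z `&` ball x n.+1%:R)); last first.
  apply/seteqP; split => [y Zy|y [n _ []]//].
  exists (Num.bound (mdist x y)) => //; split => //; rewrite ballEmdist/=.
  rewrite (lt_le_trans (archi_boundP _)) ?mdist_ge0// ler_nat leqnSn//.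
apply: negligible_bigcup => n; apply/negligibleP; first exact: measurableI.
have r0 : (0 < n.+1%:R :> R)%R by rewrite ltr0n.
have [t ht] := scaleP x r0.
have fin : \int[mu]_(y in ball x n.+1%:R) dist_weight E beta y < +oo.
  have [m m0 mE] := measure_ball_fin mu_balls x r0.
  by rewrite (le_lt_trans (hK _ _ _ r0 ht))// mE -EFinM ltry.
have mZB : measurable (Z `&` ball x n.+1%:R) by exact: measurableI.
have : +oo * mu (Z `&` ball x n.+1%:R) < +oo.
  rewrite (le_lt_trans _ fin)//.
  apply: (@le_trans _ _ (\int[mu]_(y in Z `&` ball x n.+1%:R) dist_weight E beta y)).
    apply: integral_ge_cst => // y [yZ _].
    by rewrite /dist_weight set_distE// yZ epow0_lt0// oppr_lt0.
  exact: (ge0_subset_integral _ mZB (mB _ _) (mw _) (fun y _ => w0 _ y) (@subIsetr _ _ _)).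
have := measure_ge0 mu (Z `&` ball x n.+1%:R); rewrite le_eqVlt => /predU1P[//|m0].
by rewrite gt0_mulye// ltxx.
Qed.

Lemma weight_dist_weight (alpha : R) : 0 < lower_assouad_codim mu E ->
  integrable_exponent mu E alpha -> weight mu (dist_weight E alpha).
Proof.
move=> E_codim ha; split; first exact: (mw (A := setT)).
- apply: negligibleS (negligible_dist_to_eq0 E_codim) => y /= yw.
  apply: contrapT => /eqP yE; apply: yw.
  have y0 : (0 < dist_to E y)%R by rewrite lt_neqAle eq_sym yE dist_to_ge0.
  by rewrite dist_weight_pos// lte_fin powR_gt0.
- move=> x r r0; have [K K0 hK] := integral_dist_weight_ball mu_balls E0 D0 ha.
  have [t ht] := scaleP x r0.
  have [m m0 mE] := measure_ball_fin mu_balls x r0.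
  by rewrite (le_lt_trans (hK _ _ _ r0 ht))// mE -EFinM ltry.
Qed.

(** The dual weight [w `^ (- (p - 1)^-1)] is again a power of the distance, of
    exponent [alpha / (1 - p)]; both averages have their typical size and the
    powers of the scale cancel. *)
Lemma muckenhoupt_p_dist_weight (p alpha : R) : (1 < p)%R ->
  integrable_exponent mu E alpha ->
  integrable_exponent mu E (alpha / (1 - p)) ->
  muckenhoupt_p mu p (dist_weight E alpha).
Proof.
move=> p1 /average_dist_weight_le[K K0 hK] /average_dist_weight_le[L L0 hL].
have pB1 : (0 < p - 1)%R by rewrite subr_gt0.
exists (K * L `^ (p - 1))%R => [|x r r0]; first by rewrite mulr_gt0 ?powR_gt0.
have [t ht] := scaleP x r0; have [t0 _ _] := ht.
rewrite (_ : (fun y => epow _ _) = dist_weight E (alpha / (1 - p))); last first.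
  apply/funext => y; rewrite /dist_weight set_distE// epow_epow ?dist_to_ge0//.
  by congr epow; field; apply/andP; split; lra.
have -> : (K * L `^ (p - 1))%R =
    (K * t `^ (- alpha) * (L * t `^ (- (alpha / (1 - p)))) `^ (p - 1))%R.
  rewrite powRM ?powR_ge0 ?(ltW L0)// -powRrM mulrACA -powRD; last first.
    by apply/implyP => _; rewrite gt_eqF.
  rewrite (_ : - alpha + _ = 0)%R ?powRr0 ?mulr1//.
  by field; lra.
rewrite EFinM lee_pmul ?average_ge0 ?poweR_ge0//; first exact: hK.
rewrite -poweR_EFin gt0_ler_poweR ?(ltW pB1) ?hL//.
- by rewrite in_itv/= average_ge0//= leey.
- by rewrite in_itv/= leey lee_fin andbT mulr_ge0 ?powR_ge0// ltW.
Qed.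

(** Nonnegative powers of the distance are at most their value at the scale [t], so
    the essential supremum of the inverse weight is at most [t `^ alpha]. *)
Lemma muckenhoupt_1_dist_weight (alpha : R) : (0 <= alpha)%R ->
  integrable_exponent mu E alpha -> muckenhoupt_1 mu (dist_weight E alpha).
Proof.
move=> a0 /average_dist_weight_le[K K0 hK]; exists K => // x r r0.
have [t ht] := scaleP x r0; have [t0 dt _] := ht.
have -> : K = (K * t `^ (- alpha) * t `^ alpha)%R.
  by rewrite powRN mulfVK// gt_eqF// powR_gt0.
rewrite EFinM.
apply: (@le_trans _ _ (average mu (ball x r) (dist_weight E alpha) * (t `^ alpha)%:E)).
  rewrite lee_wpmul2l ?average_ge0//.
  apply/ess_supP; apply: aeW => y; rewrite /patch; case: ifPn => [|_]; last exact: leNye.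
  rewrite inE => /dt yt.
  rewrite inve_epow opprK set_distE// -epow_EFin// le_epow// dist_to_ge0//.
by rewrite lee_wpmul2r ?lee_fin ?powR_ge0// hK.
Qed.

(** Splitting at an arbitrary height [tau] of the distance interpolates between
    a bounded function and a more singular integrable power. *)
Lemma epow_le_split (a tau alpha gamma : R) : (0 <= a)%R -> (0 < tau)%R ->
  (0 <= alpha < gamma)%R ->
  epow a%:E (- alpha) <=
    (tau `^ (- alpha))%:E + (tau `^ (gamma - alpha))%:E * epow a%:E (- gamma).
Proof.
move=> a0 tau0 /andP[alpha0 ag]; have g0 := le_lt_trans alpha0 ag.
move: a0; rewrite le_eqVlt => /predU1P[<-|a0].
  rewrite (epow0_lt0 (s := (- gamma)%R)) ?oppr_lt0// gt0_muley ?addey ?leey//.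
  by rewrite lte_fin powR_gt0.
rewrite !epow_EFin// -EFinM -EFinD lee_fin.
have [ta|at_] := leP tau a.
  by rewrite (le_trans (ler_npowR (a := tau) _ _)) ?oppr_le0 ?tau0// lerDl mulr_ge0 ?powR_ge0.
have -> : (a `^ (- alpha) = a `^ (gamma - alpha) * a `^ (- gamma))%R.
  rewrite -powRD; last by apply/implyP => _; rewrite gt_eqF.
  by congr powR; ring.
rewrite (le_trans (y := (tau `^ (gamma - alpha) * a `^ (- gamma))%R))//.
  rewrite ler_pM2r ?powR_gt0// ge0_ler_powR ?nnegrE ?subr_ge0 ?(ltW a0) ?(ltW tau0) ?(ltW at_)//.
  exact: ltW.
by rewrite lerDr powR_ge0.
Qed.

(** For [F] of relative measure [u] in a ball of scale [t], splitting at the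
    distance [tau = t * u `^ gamma^-1] balances the two terms, which are both a constant
    times [u `^ (1 - alpha / gamma)] times the typical size of the weight of the ball;
    this replaces the usual detour through a reverse Hölder inequality. *)
Lemma muckenhoupt_infty_dist_weight (alpha : R) : (0 <= alpha)%R ->
  alpha%:E < lower_assouad_codim mu E -> muckenhoupt_infty mu (dist_weight E alpha).
Proof.
move=> a0 /exponent_above[gamma ag /or_intror hg].
have [K K0 hK] := integral_dist_weight_ball mu_balls E0 D0 (hg _).
have g0 := le_lt_trans a0 ag.
exists (1 + K)%R, (1 - alpha / gamma)%R; split.
- by rewrite addr_gt0.
- by rewrite subr_gt0 ltr_pdivrMr// mul1r.
move=> x r F r0 mF FB; have [t ht] := scaleP x r0; have [t0 dt _] := ht.
have [b b0 bE] := measure_ball_fin mu_balls x r0.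
have : mu F <= b%:E by rewrite -bE le_measure ?inE.
have : 0 <= mu F by [].
case mE : (mu F) => [m| |]//; rewrite !lee_fin le_eqVlt => /predU1P[m0|m0] mb.
  rewrite null_set_integral ?mE -?m0//.
  by rewrite !mule_ge0 ?poweR_ge0 ?integral_ge0// lee_fin addr_ge0 ?ltW.
rewrite bE inver gt_eqF// -EFinM.
set u := (m / b)%R.
have u0 : (0 < u)%R by rewrite divr_gt0.
have mub : m = (u * b)%R by rewrite mulfVK// gt_eqF.
clearbody u.
apply: (@le_trans _ _ (((1 + K) * u `^ (1 - alpha / gamma))%:E *
    ((t `^ (- alpha))%:E * mu (ball x r)))); last first.
  rewrite EFinM lee_wpmul2l ?lee_fin ?mulr_ge0 ?powR_ge0 ?addr_ge0 ?(ltW K0)//.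
  apply: integral_ge_cst => // [|y /dt yt]; first by rewrite lee_fin powR_ge0.
  by rewrite /dist_weight set_distE// -epow_EFin// ge_epow ?oppr_le0// dist_to_ge0.
pose tau := (t * u `^ gamma^-1)%R.
have tau0 : (0 < tau)%R by rewrite mulr_gt0 ?powR_gt0.
apply: (@le_trans _ _ (\int[mu]_(y in F)
    ((tau `^ (- alpha))%:E + (tau `^ (gamma - alpha))%:E * dist_weight E gamma y))).
  apply: ge0_le_integral => //.
  - apply: emeasurable_funD => //; apply: emeasurable_funM => //.
  - move=> y _; rewrite /dist_weight set_distE//.
    by rewrite epow_le_split ?dist_to_ge0// a0.
rewrite ge0_integralD//; last 3 first.
- by move=> y _; rewrite lee_fin powR_ge0.
- by move=> y _; rewrite mule_ge0// lee_fin powR_ge0.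
- by apply: emeasurable_funM.
rewrite integral_cst// ge0_integralZl//; last by rewrite lee_fin powR_ge0.
have : \int[mu]_(y in F) dist_weight E gamma y <= (K * t `^ (- gamma))%:E * mu (ball x r).
  apply: le_trans (hK x r t r0 ht).
  exact: (ge0_subset_integral _ mF (mB _ _) (mw _) (fun y _ => w0 _ y)).
move=> /(lee_wpmul2l (x := (tau `^ (gamma - alpha))%:E)).
rewrite lee_fin powR_ge0 => /(_ isT) /(leeD (lexx ((tau `^ (- alpha))%:E * mu F))).
move=> /le_trans; apply.
rewrite mE bE mub -!EFinM -EFinD lee_fin le_eqVlt; apply/orP; left; apply/eqP.
rewrite /tau !powRM ?powR_ge0 ?(ltW t0)// -!powRrM.
have -> : (t `^ (- alpha) = t `^ (gamma - alpha) * t `^ (- gamma))%R.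
  rewrite -powRD; last by apply/implyP => _; rewrite gt_eqF.
  by congr powR; ring.
have -> : (gamma^-1 * (gamma - alpha) = 1 - alpha / gamma)%R.
  by field; rewrite gt_eqF.
have -> : (u `^ (1 - alpha / gamma) = u * u `^ (gamma^-1 * - alpha))%R.
  rewrite -{2}(powRr1 (ltW u0)) -powRD; last by apply/implyP => _; rewrite gt_eqF.
  by congr powR; ring.
ring.
Qed.

End muckenhoupt_dist_weight.

(** * The theorem on powers of the distance *)

Theorem theorem3p4 (d : measure_display) (R : realType) (X : borelMetricType d R)
    (mu : {measure set X -> \bar R})
    (X_two_points : exists x y : X, x <> y)
    (mu_balls : finite_positive_on_balls mu)
    (mu_doubling : doubling mu)
    (E : set X) (E_nonempty : E !=set0) (E_closed : closed E)
    (alpha : R) :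
  let w := dist_weight E alpha in
  [/\ (* (A) *)
      (0 <= alpha)%R -> alpha%:E < lower_assouad_codim mu E ->
        forall p : \bar R, 1 <= p -> muckenhoupt mu p w,
      (* (B) *)
      forall p : R, (alpha < 0)%R -> (1 < p)%R ->
        (alpha / (1 - p))%:E < lower_assouad_codim mu E ->
        muckenhoupt mu p%:E w
    & (* (C) *)
      (Num.max 0 alpha)%:E < lower_assouad_codim mu E ->
        (\bigcup_(p in [set p : \bar R | (1 <= p < +oo)%E]) muckenhoupt mu p) w].
Proof.
have [D D0 scaleP] := exists_ball_scale E_nonempty X_two_points mu_doubling.
have weight_w := weight_dist_weight mu_balls E_nonempty D0 scaleP.
have A_p p a := @muckenhoupt_p_dist_weight _ _ _ _ _ mu_balls E_nonempty _ D0 scaleP p a.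
have A_1 a := @muckenhoupt_1_dist_weight _ _ _ _ _ mu_balls E_nonempty _ D0 scaleP a.
have A_infty a := @muckenhoupt_infty_dist_weight _ _ _ _ _ mu_balls E_nonempty _ D0 scaleP a.
have dual_gt0 p : (alpha < 0)%R -> (1 < p)%R -> (0 < alpha / (1 - p))%R.
  by move=> a0 p1; rewrite -mulrNN -invrN divr_gt0//; lra.
move=> w.
have partA : (0 <= alpha)%R -> alpha%:E < lower_assouad_codim mu E ->
    forall p : \bar R, 1 <= p -> muckenhoupt mu p w.
  move=> a0 codim p p1; split.
    by apply: weight_w; [exact: le_lt_trans codim|right].
  case: p p1 => [p| |]// p1; last exact: A_infty.
  case: eqVneq => [_|pN1]; first by apply: A_1 => //; right.
  have {}p1 : (1 < p)%R by rewrite lt_neqAle eq_sym pN1.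
  split => //; apply: A_p => //; [by right|left].
  by rewrite ler_ndivrMr ?mul0r// subr_lt0.
have partB p : (alpha < 0)%R -> (1 < p)%R ->
    (alpha / (1 - p))%:E < lower_assouad_codim mu E -> muckenhoupt mu p%:E w.
  move=> a0 p1 codim; split.
    apply: weight_w; last by left; exact: ltW.
    by apply: lt_trans codim; rewrite lte_fin dual_gt0.
  by rewrite gt_eqF//; split => //; apply: A_p => //; [left; exact: ltW|right].
split => // codim; have [a0|a0] := leP 0%R alpha.
  exists 1; first by rewrite /= lexx ltry.
  by apply: partA => //; rewrite max_r in codim.
move: codim; rewrite max_l ?(ltW a0)// => /exponent_above[gamma g0 codim].
(* [p = 1 - alpha / gamma] solves [alpha / (1 - p) = gamma] *)
have p1 : (1 < 1 - alpha / gamma)%R by rewrite ltrDl oppr_gt0 pmulr_llt0 ?invr_gt0.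
exists (1 - alpha / gamma)%:E; first by rewrite /= ltry lee_fin ltW.
apply: partB => //.
have -> : (alpha / (1 - (1 - alpha / gamma)) = gamma)%R.
  by rewrite opprB addrCA subrr addr0 invf_div mulrCA divff ?mulr1// lt_eqF.
exact: codim.
Qed.
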